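(* Let $k,n\in\mathbb{N}$. If $A\in\mathrm{Mat}_{kn,n}$ and $P\in\mathrm{Mat}_n$, then $$\operatorname{wrdet}_k(AP)=(\det P)^k\operatorname{wrdet}_k(A).$$ Namely, $\operatorname{wrdet}_k$ is a relative invariant of $GL_n(\mathbb{C})$ in the algebra of polynomial functions on $\mathrm{Mat}_{kn,n}(\mathbb{C})$ with respect to the right regular representation.
   Context: $\mathrm{Mat}_{m,n}$ is the set of $m\times n$ matrices with entries in a commutative $\mathbb{C}$-algebra, $\mathrm{Mat}_n=\mathrm{Mat}_{n,n}$. $\mathfrak{S}_N$ is the symmetric group of degree $N$ and $\nu_N(w)$ is the number of cycles of $w\in\mathfrak{S}_N$ (fixed points included). For $B=(b_{ij})\in\mathrm{Mat}_N$, $\det_k B:=\sum_{w\in\mathfrak{S}_N}(-\tfrac1k)^{N-\nu_N(w)}b_{w(1)1}\cdots b_{w(N)N}$. For $A=(\boldsymbol{a}_1,\dots,\boldsymbol{a}_n)\in\mathrm{Mat}_{m,n}$ (columns $\boldsymbol a_i$), $A^{[k]}=(\boldsymbol{a}_1,\dots,\boldsymbol{a}_1,\dots,\boldsymbol{a}_n,\dots,\boldsymbol{a}_n)\in\mathrm{Mat}_{m,kn}$, each column repeated $k$ times consecutively. The $k$-th wreath determinant of $A\in\mathrm{Mat}_{kn,n}$ is $\operatorname{wrdet}_k A:=\det_k(A^{[k]})$. The right regular representation is $(P\cdot f)(A)=f(AP)$ for $P\in GL_n(\mathbb{C})$. *)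

(* Defs.v *)
From mathcomp Require Export all_boot all_order all_algebra all_fingroup.
From mathcomp Require Export reals.
From mathcomp Require Export complex.
From mathcomp Require Export mpoly.

Set Implicit Arguments.
Unset Strict Implicit.
Unset Printing Implicit Defensive.

Import GRing.Theory.
Local Open Scope ring_scope.

Definition ncycles (N : nat) (w : 'S_N) : nat := #|porbits w|.

Definition det_k (K : fieldType) (R : comAlgType K) (k N : nat)
    (B : 'M[R]_N) : R :=
  \sum_(w : 'S_N)
    (- (k%:R^-1 : K)) ^+ (N - ncycles w) *: \prod_(j < N) B (w j) j.

Lemma block_index_subproof (k n : nat) (j : 'I_(k * n)) : (j %/ k < n)%N.
Proof.
case: k j => [|k] [j /= ltj]; first by case: (notF ltj).
by rewrite ltn_divLR // mulnC.
Qed.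

Definition block_index (k n : nat) (j : 'I_(k * n)) : 'I_n :=
  Ordinal (block_index_subproof j).

Definition col_repeat (T : Type) (k m n : nat) (A : 'M[T]_(m, n)) :
    'M[T]_(m, k * n) :=
  \matrix_(i < m, j < k * n) A i (block_index j).

Definition wrdet (K : fieldType) (R : comAlgType K) (k n : nat)
    (A : 'M[R]_(k * n, n)) : R :=
  det_k k (col_repeat k A).

(* The indeterminates are the matrix entries, enumerated in the order of mxvec. *)
Definition polynomial_function (K : fieldType) (m n : nat)
    (f : 'M[K]_(m, n) -> K) : Prop :=
  exists p : {mpoly K[m * n]}, forall A, f A = p.@[fun i => mxvec A ord0 i].

Definition right_regular (K : fieldType) (m n : nat) (P : 'M[K]_n)
    (f : 'M[K]_(m, n) -> K) : 'M[K]_(m, n) -> K :=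
  fun A => f (A *m P).

(* GL_n(K) is the predicate unitmx on 'M[K]_n; a character is only constrained
   there.  Multiplicativity together with chi 1 = 1 makes chi nonzero on GL_n. *)
Definition GL_character (K : fieldType) (n : nat) (chi : 'M[K]_n -> K) : Prop :=
  chi 1%:M = 1 /\
  {in unitmx &, {morph chi : P Q / P *m Q >-> P * Q}}.

Definition GL_relative_invariant (K : fieldType) (m n : nat)
    (chi : 'M[K]_n -> K) (f : 'M[K]_(m, n) -> K) : Prop :=
  [/\ polynomial_function f, GL_character chi &
      forall P, P \in unitmx -> right_regular P f =1 (fun A => chi P * f A)].

(* Main.v *)
Require Import Defs.
From mathcomp Require Import fraction ring.

(** Write [c] for [-1/k], so that [1 + c k = 0], and let [det_c] be the
    deformed determinant [\sum_w c^(N - cycles of w) \prod_j B (w j) j].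

    The one property of [det_c] that matters is that it vanishes on a matrix
    with [k + 1] equal columns ([alpha_det_eq_cols]).  Let [J] be the set of
    these columns and fix [x] in [J].  Each [w] is uniquely of the form
    [tperm x y * u], where [y] is in [J] and [u] has no element of [J] other
    than [x] in the cycle of [x].  All these [w] have the same product of
    entries as [u].  The choice [y = x] gives [u] itself, and each of the [k]
    other choices merges two cycles of [u], hence contributes one more factor
    [c].  So every [u] contributes a multiple of [1 + c k = 0].

    Now expand [wrdet (A P)] by multilinearity in the columns: it is a sum over
    the maps [f] from the [k n] columns to the [n] columns of [A], with
    coefficient [\prod_l P (f l) (block of l)].  By the vanishing property only
    those [f] remain that take each value at most, hence exactly, [k] times.
    If [P] is triangular, a nonzero coefficient forces [f] to lie on one side
    of the block map pointwise; both have the same sum of values, so they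
    coincide, and the only term left is [(\det P)^k wrdet A].

    The relation is stable under products.  It therefore holds for
    transpositions, which are products of triangular matrices, for permutation
    matrices, and by the LUP decomposition for every matrix over a field
    ([right_relative_field]).  Since it is a polynomial identity in the entries
    of [A] and [P], the case of the fraction field of a polynomial ring in
    these entries gives it over every commutative algebra
    ([alpha_wrdet_right_relative]). *)

Set Implicit Arguments.
Unset Strict Implicit.
Unset Printing Implicit Defensive.

Import GRing.Theory.
Local Open Scope ring_scope.

(** * First return to a set along a permutation *)

Section FirstReturn.

Variables (T : finType) (J : {set T}) (x : T).
Hypothesis xJ : x \in J.

Lemma returns (u : {perm T}) : exists m, iter m.+1 u x \in J.
Proof.
by exists #[u]%g.-1; rewrite prednK ?order_gt0// -permX expg_order perm1.
Qed.

Definition first_return (u : {perm T}) : T := iter (ex_minn (returns u)).+1 u x.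

Lemma first_return_in u : first_return u \in J.
Proof. by rewrite /first_return; case: ex_minnP. Qed.

(** Up to the first return the orbit of [x] stays outside [J], where [t] is the
    identity, so [t] acts only at the very end.  This equivariance is what makes
    the decomposition [w = tperm x y * u] bijective. *)
Lemma first_return_mul (u t : {perm T}) :
  perm_on J t -> first_return (u * t)%g = t (first_return u).
Proof.
move=> tJ; rewrite /first_return; case: ex_minnP => m mJ mmin.
case: ex_minnP => m' m'J m'min.
have iterE i : (forall i', (i' < i)%N -> iter i'.+1 u x \notin J) ->
    iter i.+1 (u * t)%g x = t (iter i.+1 u x).
  elim: i => [|i IHi] out; first by rewrite /= permM.
  rewrite iterS IHi => [|i' lti]; last by apply: out; rewrite ltnW.
  by rewrite permM (out_perm tJ (out i (ltnSn i))).
have out i : (i < m')%N -> iter i.+1 u x \notin J.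
  by apply: contraTN => /m'min; rewrite -leqNgt.
have lemm' : (m <= m')%N by apply: mmin; rewrite iterE// perm_closed.
have outm i : (i < m)%N -> iter i.+1 u x \notin J.
  by move=> ltim; apply: out; apply: leq_trans lemm'.
have : (m' <= m)%N by apply: m'min; rewrite -(perm_closed _ tJ) -iterE.
move=> lem'm; have <- : m = m' by apply/eqP; rewrite eqn_leq lemm'.
exact: iterE.
Qed.

(** If the first return to [J] is at [x], the whole cycle of [x] has been
    traversed by then. *)
Lemma first_return_isolated u y :
  first_return u = x -> y \in J -> y != x -> y \notin porbit u x.
Proof.
rewrite /first_return; case: ex_minnP => m mJ mmin returnx yJ; apply: contraNN.
have iter_mod i : iter i u x = iter (i %% m.+1) u x.
  rewrite {1}(divn_eq i m.+1) addnC iterD; congr (iter _ _ _).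
  by elim: (i %/ m.+1)%N => // q IHq; rewrite mulSn iterD IHq.
case/porbitP => i; rewrite permX iter_mod => yE.
case: (i %% m.+1)%N (ltn_pmod i (ltn0Sn m)) yE => [|j] ltj yE; first exact/eqP.
by have /mmin : iter j.+1 u x \in J; [rewrite -yE | rewrite leqNgt -ltnS ltj].
Qed.

End FirstReturn.

(** * Cycle counts *)

Lemma ncycles_le N (w : 'S_N) : (ncycles w <= N)%N.
Proof. by rewrite -[N in leqRHS]card_ord leq_imset_card. Qed.

Lemma ncycles_merge N (w : 'S_N) (x y : 'I_N) :
  y \notin porbit w x -> (N - ncycles (tperm x y * w) = (N - ncycles w).+1)%N.
Proof.
move=> xy; have neq : x != y by apply: contraNneq xy => <-; rewrite porbit_id.
have := porbits_mul_tperm w x y; rewrite /= porbit_sym xy neq/=.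
have := ncycles_le w; rewrite /ncycles => le1 E.
by rewrite -subSn // addn2 addn1 in E *; case: E => <-; rewrite subSS.
Qed.

(** * The alpha-determinant *)

Section AlphaDeterminant.

Variable S : comNzRingType.
Implicit Types c : S.

(** Vere-Jones' alpha-determinant.  The parameter is an element of the ring of
    the entries, so that it can be transported along ring morphisms. *)
Definition alpha_det c N (B : 'M[S]_N) : S :=
  \sum_(w : 'S_N) c ^+ (N - ncycles w) * \prod_j B (w j) j.

(** The cycle of [x] is isolated from [J] exactly when the first return [h] of
    [x] to [J] is [x].  By equivariance of [h], the permutations with [h w = y]
    are the [tperm x y * u] with [h u = x]. *)
Lemma alpha_det_eq_cols c k N (B : 'M[S]_N) (J : {set 'I_N}) :
    1 + c * k%:R = 0 -> #|J| = k.+1 ->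
    (forall i, {in J &, forall j j', B i j = B i j'}) ->
  alpha_det c B = 0.
Proof.
move=> c0 cardJ eqB.
have /set0Pn [x xJ] : J != set0 by rewrite -card_gt0 cardJ.
(* The inverse is used because multiplying [w] on the left by a permutation of
   [J], which permutes equal columns, multiplies [w^-1] on the right. *)
pose h (w : 'S_N) := first_return xJ w^-1.
have tpermJ y : y \in J -> perm_on J (tperm x y).
  move=> yJ; apply/subsetP => z; rewrite inE.
  by case: tpermP => [->|->|]; rewrite ?eqxx.
have hM y w : y \in J -> h (tperm x y * w)%g = tperm x y (h w).
  by move=> yJ; rewrite /h invMg tpermV first_return_mul// tpermJ.
have prodM y w : y \in J ->
    \prod_j B ((tperm x y * w)%g j) j = \prod_j B (w j) j.
  move=> yJ; rewrite (reindex_inj (@perm_inj _ (tperm x y)))/=.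
  apply: eq_bigr => j _; rewrite permM tpermK.
  by case: tpermP => [->|->|]//; apply: eqB.
rewrite /alpha_det (partition_big h (mem J))/=; last first.
  by move=> w _; apply: first_return_in.
transitivity (\sum_(y in J) \sum_(w | h w == x)
    c ^+ (N - ncycles w) * (if y == x then 1 else c) * \prod_j B (w j) j).
  apply: eq_bigr => y yJ; rewrite (reindex_inj (mulgI (tperm x y))).
  apply: eq_big => [w|w hwx].
    by rewrite hM// (canF_eq (tpermK x y)) tpermR.
  rewrite prodM//; congr (_ * _).
  move: hwx; rewrite hM// (canF_eq (tpermK x y)) tpermR.
  have [->|yx] := eqVneq y x; first by rewrite tperm1 mul1g mulr1.
  move=> /eqP hwx; have := first_return_isolated hwx yJ yx.
  by rewrite porbitV => /ncycles_merge ->; rewrite exprSr.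
rewrite exchange_big big1// => w _.
rewrite -mulr_suml -mulr_sumr (bigD1 x)//= eqxx.
rewrite (eq_bigr (fun=> c)) => [|y /andP[_ /negbTE ->]//].
rewrite sumr_const (_ : #|_| = k) ?c0 ?mulr0 ?mul0r//; first last.
  apply/eqP; rewrite -eqSS -cardJ (cardsD1 x J) xJ; apply/eqP; congr _.+1.
  by apply: eq_card => y; rewrite !inE andbC.
by rewrite -[c *+ k]mulr_natr c0 mulr0 mul0r.
Qed.

Lemma alpha_det_mulmx c N n (A : 'M[S]_(N, n)) (Q : 'M[S]_(n, N)) :
  alpha_det c (A *m Q) = \sum_(f : {ffun 'I_N -> 'I_n})
    (\prod_j Q (f j) j) * alpha_det c (colsub f A).
Proof.
under eq_bigr do rewrite /alpha_det mulr_sumr.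
rewrite exchange_big; apply: eq_bigr => w _.
have -> : \prod_j (A *m Q) (w j) j = \prod_j \sum_i A (w j) i * Q i j.
  by apply: eq_bigr => j _; rewrite mxE.
rewrite bigA_distr_bigA mulr_sumr; apply: eq_bigr => f _.
rewrite big_split [RHS]mulrC -mulrA.
by congr (_ * (_ * _)); apply: eq_bigr => j _; rewrite mxE.
Qed.

Lemma alpha_det_big_fiber c k N n (A : 'M[S]_(N, n)) (f : 'I_N -> 'I_n) i :
    1 + c * k%:R = 0 -> (k < #|[pred j | f j == i]|)%N ->
  alpha_det c (colsub f A) = 0.
Proof.
move=> c0 /card_geqP [s [uniq_s size_s sf]].
apply: (alpha_det_eq_cols (J := [set j in s])) c0 _ _.
  by rewrite cardsE (card_uniqP uniq_s).
move=> a j j'; rewrite !inE !mxE.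
by move=> /sf/eqP -> /sf/eqP ->.
Qed.

End AlphaDeterminant.

Lemma alpha_det_map (S S' : comNzRingType) (h : {rmorphism S -> S'}) c N
    (B : 'M[S]_N) :
  h (alpha_det c B) = alpha_det (h c) (map_mx h B).
Proof.
rewrite rmorph_sum; apply: eq_bigr => w _; rewrite rmorphM rmorphXn rmorph_prod.
by congr (_ * _); apply: eq_bigr => j _; rewrite mxE.
Qed.

(** * Maps with small fibers *)

Section Blocks.

Variables k n : nat.
Implicit Types f g : 'I_(k * n) -> 'I_n.

Definition balanced f := forall i, (#|[pred l | f l == i]| <= k)%N.

(** The [n] fibers partition a set of [k * n] elements, so none can have fewer
    than [k] of them. *)
Lemma balanced_fiber f : balanced f -> forall i, #|[pred l | f l == i]| = k.
Proof.
move=> bal.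
have [_] := leqif_sum (fun i (_ : true) => leqif_eq (bal i)).
rewrite sum_nat_const card_ord.
have -> : (\sum_i #|[pred l | f l == i]| = k * n)%N.
  rewrite -[RHS]card_ord -sum1_card (partition_big f xpredT)//=.
  by apply: eq_bigr => i _; rewrite sum1_card; apply: eq_card.
rewrite [(n * k)%N]mulnC eqxx => /esym/forallP eqk i.
exact/eqP/(implyP (eqk i)).
Qed.

Lemma balanced_prod (S : comNzRingType) (F : 'I_n -> S) f :
  balanced f -> \prod_l F (f l) = (\prod_i F i) ^+ k.
Proof.
move=> /balanced_fiber bal; rewrite (partition_big f xpredT)//= -prodrXl.
apply: eq_bigr => i _; rewrite (eq_bigr (fun=> F i)) => [|l /eqP -> //].
by rewrite prodr_const -[in RHS](bal i).
Qed.

Lemma balanced_sum f : balanced f -> (\sum_l f l = \sum_(i < n) i * k)%N.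
Proof.
move=> /balanced_fiber bal; rewrite (partition_big f xpredT)//=.
apply: eq_bigr => i _; rewrite (eq_bigr (fun=> i : nat)) => [|l /eqP -> //].
by rewrite sum_nat_const mulnC -[in RHS](bal i).
Qed.

(** The sum of the values is the same for all balanced maps. *)
Lemma balanced_le_eq f g :
  balanced f -> balanced g -> (forall l, f l <= g l)%N -> f =1 g.
Proof.
move=> /balanced_sum sf /balanced_sum sg lefg l.
have [_] := leqif_sum (fun l (_ : true) => leqif_eq (lefg l)).
by rewrite sf sg eqxx => /esym/forallP/(_ l)/= /eqP/val_inj.
Qed.

Lemma balanced_block_index : balanced (@block_index k n).
Proof.
(* Within a block, an index is determined by its residue modulo [k]. *)
case: (posnP k) => [k0|k_gt0] i.
  by rewrite (leq_trans (max_card _))// card_ord {1}k0.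
rewrite -[in leqRHS](card_ord k).
pose residue (l : 'I_(k * n)) := Ordinal (ltn_pmod l k_gt0).
apply: (@leq_card_in _ _ residue) => l l'.
rewrite !inE => /eqP <- /eqP/(congr1 val)/= eq_div /(congr1 val)/= eq_mod.
by apply: val_inj; rewrite /= (divn_eq l k) -eq_div eq_mod -divn_eq.
Qed.

Lemma col_repeatE T m (A : 'M[T]_(m, n)) :
  col_repeat k A = colsub (@block_index k n) A.
Proof. by apply/matrixP => a l; rewrite !mxE. Qed.

Lemma col_repeat_mulmx (S : comNzRingType) m (A : 'M[S]_(m, n)) (P : 'M[S]_n) :
  col_repeat k (A *m P) = A *m col_repeat k P.
Proof.
by apply/matrixP => a l; rewrite !mxE; apply: eq_bigr => i _; rewrite mxE.
Qed.

End Blocks.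

(** * The action of right multiplication *)

Section RightMultiplication.

Variables (S : comNzRingType) (k n : nat) (c : S).
Hypothesis c0 : 1 + c * k%:R = 0.
Implicit Types (A : 'M[S]_(k * n, n)) (P Q : 'M[S]_n).

Definition alpha_wrdet A : S := alpha_det c (col_repeat k A).

Definition right_relative P :=
  forall A, alpha_wrdet (A *m P) = (\det P) ^+ k * alpha_wrdet A.

(** The hypothesis isolates the term of the block map in the expansion of the
    left-hand side: the other balanced maps have a zero coefficient, and the
    maps that are not balanced select more than [k] copies of some column. *)
Lemma alpha_wrdet_mulmx_rigid A P :
    (forall f : 'I_(k * n) -> 'I_n, balanced f ->
      (forall l, P (f l) (block_index l) != 0) -> f =1 @block_index k n) ->
  alpha_wrdet (A *m P) = (\prod_i P i i) ^+ k * alpha_wrdet A.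
Proof.
move=> rigid; rewrite /alpha_wrdet col_repeat_mulmx alpha_det_mulmx.
rewrite (bigD1 [ffun l => block_index l])//= [X in _ + X]big1 ?addr0.
  rewrite -(balanced_prod (fun i => P i i) (@balanced_block_index k n)).
  congr (_ * _); first by apply: eq_bigr => l _; rewrite mxE ffunE.
  rewrite col_repeatE; congr alpha_det.
  by apply/matrixP => a l; rewrite !mxE ffunE.
move=> f neqf.
have [/forallP nz|] := boolP [forall l, P (f l) (block_index l) != 0];
  first last.
  rewrite negb_forall => /existsP[l]; rewrite negbK => /eqP P0.
  by rewrite (bigD1 l)//= mxE P0 !mul0r.
have [i|bal] := pickP (fun i => k < #|[pred l | f l == i]|)%N.
  by move=> /(alpha_det_big_fiber A c0) ->; rewrite mulr0.
case/eqP: neqf; apply/ffunP => l; rewrite ffunE; apply: rigid => // i.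
by rewrite leqNgt bal.
Qed.

Lemma right_relative_lower P : is_trig_mx P -> right_relative P.
Proof.
move=> trigP A; rewrite (det_trig trigP) alpha_wrdet_mulmx_rigid// => f bal nz.
move=> l; apply/esym; move: l.
apply: balanced_le_eq => //; first exact: balanced_block_index.
move=> l; rewrite leqNgt; apply: contra (nz l) => ltl.
by rewrite (is_trig_mxP trigP).
Qed.

Lemma right_relative_upper P : is_trig_mx P^T -> right_relative P.
Proof.
move=> trigP A; rewrite -det_tr (det_trig trigP).
rewrite alpha_wrdet_mulmx_rigid => [|f bal nz].
  by under [in RHS]eq_bigr do rewrite mxE.
apply: balanced_le_eq => //; first exact: balanced_block_index.
move=> l; rewrite leqNgt; apply: contra (nz l) => ltl.
by have := is_trig_mxP trigP _ _ ltl; rewrite mxE => ->.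
Qed.

Lemma right_relative_mul P Q :
  right_relative P -> right_relative Q -> right_relative (P *m Q).
Proof.
by move=> relP relQ A; rewrite mulmxA relQ relP det_mulmx exprMn mulrCA mulrA.
Qed.

Lemma right_relative1 : right_relative 1%:M.
Proof. by move=> A; rewrite mulmx1 det1 expr1n mul1r. Qed.

(** In the plane of [i] and [j], the product of the three transvections is the
    rotation by a right angle; a change of sign of column [i] turns it into the
    exchange of the coordinates. *)
Lemma tperm_mx_triangular (i j : 'I_n) : i != j ->
  tperm_mx i j = (1%:M + delta_mx i j) *m (1%:M - delta_mx j i)
     *m (1%:M + delta_mx i j) *m diag_mx (\row_l (-1) ^+ (l == i)) :> 'M[S]_n.
Proof.
move=> neq; have neq' : j != i by rewrite eq_sym.
rewrite !(mulmxDl, mulmxDr, mulmxN, mulNmx, mulmx1, mul1mx).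
rewrite !(mul_delta_mx_cond, eqxx, negPf neq', mulr1n, mulr0n, mul0mx).
apply/matrixP => a b; rewrite !mul_mx_diag !mxE.
have [->|bi] := eqVneq b i.
  case: tpermP => [->|->|/eqP ai /eqP aj];
    by rewrite ?eqxx ?(negPf neq) ?(negPf neq') ?(negPf ai) ?(negPf aj)/=; ring.
rewrite eq_sym in bi.
have [->|bj] := eqVneq b j; last rewrite eq_sym in bj;
  case: tpermP => [->|->|/eqP ai /eqP aj];
  rewrite ?eqxx ?(negPf neq) ?(negPf neq') ?(negPf ai) ?(negPf aj) ?(negPf bi)
    ?(negPf bj)/=; ring.
Qed.

Lemma right_relative_transvection (i j : 'I_n) (x : S) :
  i != j -> right_relative (1%:M + x *: delta_mx i j).
Proof.
move=> neq; have [leij|ltji] := leqP i j.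
  apply: right_relative_upper; apply/is_trig_mxP => a b ltab; rewrite !mxE.
  rewrite -[b == a]val_eqE gtn_eqF//= add0r.
  case: eqP => [bi|_]; rewrite ?mulr0//=; case: eqP => [aj|_]; rewrite ?mulr0//.
  by move: ltab; rewrite bi aj ltnNge leij.
apply: right_relative_lower; apply/is_trig_mxP => a b ltab; rewrite !mxE.
rewrite -[a == b]val_eqE ltn_eqF//= add0r.
case: eqP => [ai|_]; rewrite ?mulr0//=; case: eqP => [bj|_]; rewrite ?mulr0//.
by move: ltab; rewrite ai bj ltnNge ltnW.
Qed.

Lemma right_relative_tperm (i j : 'I_n) : right_relative (tperm_mx i j).
Proof.
have [->|neq] := eqVneq i j.
  by rewrite /tperm_mx tperm1 perm_mx1; apply: right_relative1.
rewrite tperm_mx_triangular//.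
have trans (a b : 'I_n) : a != b -> right_relative (1%:M + delta_mx a b).
  by rewrite -[delta_mx a b]scale1r; apply: right_relative_transvection.
apply: right_relative_mul; last first.
  by apply: right_relative_lower; apply: diag_mx_is_trig.
apply: right_relative_mul (trans _ _ neq).
apply: right_relative_mul (trans _ _ neq) _.
by rewrite -scaleN1r; apply: right_relative_transvection; rewrite eq_sym.
Qed.

Lemma right_relative_perm (s : 'S_n) : right_relative (perm_mx s).
Proof.
have [ts -> _] := prod_tpermP s; elim: ts => [|t ts IHts].
  by rewrite big_nil perm_mx1; apply: right_relative1.
rewrite big_cons perm_mxM.
exact: right_relative_mul (right_relative_tperm _ _) IHts.
Qed.

End RightMultiplication.

Lemma right_relative_field (F : fieldType) k n (c : F) (P : 'M[F]_n) :
  1 + c * k%:R = 0 -> right_relative k c P.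
Proof.
move=> c0; case: n P => [|n] P.
  by rewrite (flatmx0 P) -(flatmx0 1%:M); apply: right_relative1.
case E: (cormen_lup P) => [[Q L] U].
have := cormen_lup_correct P; have := cormen_lup_perm P.
have := cormen_lup_lower P; have := cormen_lup_upper P.
rewrite E/= => upperU lowerL /is_perm_mxP[s ->] PE.
have -> : P = perm_mx s^-1 *m (L *m U).
  by rewrite perm_mxV -[L *m U]PE mulmxA mulVmx ?unitmx_perm// mul1mx.
apply: right_relative_mul; first exact: right_relative_perm.
apply: right_relative_mul.
  apply: right_relative_lower => //; apply/is_trig_mxP => i j ltij.
  by rewrite lowerL ?(ltnW ltij)// -val_eqE ltn_eqF.
apply: right_relative_upper => //; apply/is_trig_mxP => i j ltij.
by rewrite mxE upperU.
Qed.

(** * From fields to commutative algebras *)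

Lemma map_col_repeat (S S' : comNzRingType) (h : S -> S') k m n
    (A : 'M[S]_(m, n)) :
  map_mx h (col_repeat k A) = col_repeat k (map_mx h A).
Proof. by apply/matrixP => i j; rewrite !mxE. Qed.

Lemma alpha_wrdet_map (S S' : comNzRingType) (h : {rmorphism S -> S'}) k n c
    (A : 'M[S]_(k * n, n)) :
  h (alpha_wrdet c A) = alpha_wrdet (h c) (map_mx h A).
Proof. by rewrite /alpha_wrdet alpha_det_map map_col_repeat. Qed.

(** The matrices [XA] and [XP] of independent indeterminates specialize to any
    [A] and [P], and the polynomial ring of their entries embeds into its
    fraction field.  The parameter must come from a field [K], over which these
    polynomials are taken. *)
Lemma alpha_wrdet_right_relative (K : fieldType) (S : comNzRingType)
    (iota : {rmorphism K -> S}) k n (c : K) (P : 'M[S]_n) :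
  1 + c * k%:R = 0 -> right_relative k (iota c) P.
Proof.
move=> c0 A.
pose I : finType := ('I_(k * n) * 'I_n + 'I_n * 'I_n)%type.
pose X (t : I) : {mpoly K[#|I|]} := 'X_(enum_rank t).
pose XA := \matrix_(i, j) X (inl (i, j)).
pose XP := \matrix_(i, j) X (inr (i, j)).
pose entry (t : I) :=
  match t with inl ij => A ij.1 ij.2 | inr ij => P ij.1 ij.2 end.
pose v (i : 'I_#|I|) := entry (enum_val i).
pose ev : {rmorphism {mpoly K[#|I|]} -> S} := mmap iota v.
have evC : ev c%:MP = iota c by rewrite /ev/= mmapC.
have evX t : ev (X t) = entry t.
  by rewrite /ev/= mmapX mmap1U /v enum_rankK.
have evA : map_mx ev XA = A by apply/matrixP => i j; rewrite !mxE evX.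
have evP : map_mx ev XP = P by apply/matrixP => i j; rewrite !mxE evX.
suff generic :
    alpha_wrdet c%:MP (XA *m XP) = \det XP ^+ k * alpha_wrdet c%:MP XA.
  have := congr1 ev generic.
  rewrite rmorphM rmorphXn -det_map_mx !alpha_wrdet_map map_mxM.
  by rewrite evC evA evP.
apply/eqP; rewrite -tofrac_eq; apply/eqP.
rewrite rmorphM rmorphXn -det_map_mx !alpha_wrdet_map map_mxM/=.
apply: right_relative_field.
have := congr1 (fun x => tofrac x%:MP_[#|I|]) c0.
by rewrite /= !(rmorphD, rmorphM, rmorph1, rmorph_nat, rmorph0).
Qed.

(** * The wreath determinant *)

Lemma wrdetE (K : fieldType) (S : comAlgType K) k n (A : 'M[S]_(k * n, n)) :
  wrdet A = alpha_wrdet (GRing.in_alg S (- k%:R^-1)) A.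
Proof.
by apply: eq_bigr => w _; rewrite -(rmorphXn (GRing.in_alg S)) mulr_algl.
Qed.

Lemma wrdet_mulmx (K : fieldType) (S : comAlgType K) k n
    (A : 'M[S]_(k * n, n)) (P : 'M[S]_n) :
  k%:R != 0 :> K -> wrdet (A *m P) = (\det P) ^+ k * wrdet A.
Proof.
move=> k0; rewrite !wrdetE; apply: alpha_wrdet_right_relative.
by rewrite mulNr mulVf// subrr.
Qed.

Lemma polynomial_function_wrdet (K : fieldType) k n :
  polynomial_function (fun A : 'M[K]_(k * n, n) => wrdet (R := K^o) A).
Proof.
pose X : 'M[{mpoly K[k * n * n]}]_(k * n, n) :=
  \matrix_(i, j) 'X_(mxvec_index i j).
exists (alpha_wrdet (- k%:R^-1)%:MP X) => A.
rewrite alpha_wrdet_map/= mevalC wrdetE in_algE.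
have -> : map_mx (meval (fun i => mxvec A ord0 i)) X = A.
  by apply/matrixP => i j; rewrite !mxE mevalXU mxvecE.
by congr alpha_wrdet; rewrite -[RHS]mulr1.
Qed.

Theorem lemma4p4 (R : realType) (k n : nat) (hk : (0 < k)%N) (hn : (0 < n)%N) :
  (forall (S : comAlgType R[i]) (A : 'M[S]_(k * n, n)) (P : 'M[S]_n),
      wrdet (A *m P) = (\det P) ^+ k * wrdet A) /\
  GL_relative_invariant (fun P : 'M[R[i]]_n => (\det P) ^+ k)
    (fun A : 'M[R[i]]_(k * n, n) => wrdet (R := R[i]^o) A).
Proof.
have k0 : k%:R != 0 :> R[i] by rewrite Num.Theory.pnatr_eq0 -lt0n.
split=> [S A P|]; first exact: wrdet_mulmx.
split; first exact: polynomial_function_wrdet.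
  split; first by rewrite det1 expr1n.
  by move=> P Q _ _; rewrite det_mulmx exprMn.
by move=> P _ A; apply: (@wrdet_mulmx R[i] R[i]^o).
Qed.
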